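(* Let $K$ be a compact convex body in the hyperbolic plane and let $d>0$. If $K$ has the constant shadow property with the number $d$, then $K$ is a body of constant diameter $d$.
   Context: The hyperbolic plane has curvature $-1$; $\mathcal I$ denotes the set of its ideal points. A compact convex body is a compact convex set with nonempty interior. For distinct $X,Y\in\mathcal I$, $YX$ denotes the hyperbolic line with ideal endpoints $Y$ and $X$. If $YX$ meets $K$, there are two hypercycles (distance curves) with leading line $YX$, one on each side of it (possibly degenerating to $YX$ itself), which touch $K$ and such that the strip between them contains $K$. Let $d_K^+(YX)$ and $d_K^-(YX)$ be the distances of these two hypercycles from $YX$; that is, $d_K^{\pm}(YX)$ is the maximal distance from $YX$ of a point of $K$ in the respective closed half-plane bounded by $YX$. Put $d_K(YX)=d_K^+(YX)+d_K^-(YX)$. $K$ has the constant shadow property with the number $d>0$ if $d_K(YX)=d$ for every line $YX$ which intersects $K$. $K$ is of constant diameter $d$ if its diameter (the greatest distance between two of its points) is $d$ and each boundary point of $K$ is an endpoint of a chord of $K$ of length $d$. *)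

(* Defs.v *)
From mathcomp Require Import all_boot all_order all_algebra.
From mathcomp Require Import all_classical all_reals all_analysis.

Set Implicit Arguments.
Unset Strict Implicit.
Unset Printing Implicit Defensive.

Import Order.TTheory GRing.Theory Num.Theory.
Import numFieldNormedType.Exports.

Local Open Scope classical_set_scope.
Local Open Scope ring_scope.

(* The hyperbolic plane of curvature -1 is the Beltrami-Klein disk: its points
   are the points of the open unit disk, its ideal points those of the unit
   circle, its lines the open chords, and its geodesic segments the straight
   segments.  The metric hdist induces the Euclidean topology of the open disk,
   and the disk is open in the ambient plane; hence for a subset of the disk
   hyperbolic convexity, compactness and interior are the ambient ones. *)
Notation plane R := (R^o * R^o)%type.

Section HyperbolicPlane.
Variable R : realType.
Implicit Types (p q X Y : plane R) (K : set (plane R)).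

Definition dot p q : R := p.1 * q.1 + p.2 * q.2.

Definition hplane : set (plane R) := [set p | dot p p < 1].

Definition ideal : set (plane R) := [set X | dot X X = 1].

Definition arcosh (x : R) : R := ln (x + Num.sqrt (x ^+ 2 - 1)).

(* cosh d(p, q) is minus the Minkowski product of the two points
   (1, p) / sqrt (1 - |p|^2), (1, q) / sqrt (1 - |q|^2) of the hyperboloid. *)
Definition hdist p q : R :=
  arcosh ((1 - dot p q) / Num.sqrt ((1 - dot p p) * (1 - dot q q))).

(* The line YX when Y and X are distinct ideal points. *)
Definition hline Y X : set (plane R) :=
  [set (1 - t) *: Y + t *: X | t in `]0, 1[].

Definition dist_to_line Y X p : R := inf [set hdist p q | q in hline Y X].

(* Positive (negative) exactly when p is strictly to the left (right) of YX
   directed from Y to X. *)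
Definition side Y X p : R :=
  (X.1 - Y.1) * (p.2 - Y.2) - (X.2 - Y.2) * (p.1 - Y.1).

Definition half_plane_pos Y X : set (plane R) :=
  hplane `&` [set p | 0 <= side Y X p].

Definition half_plane_neg Y X : set (plane R) :=
  hplane `&` [set p | side Y X p <= 0].

(* If K is compact and meets YX, the suprema below are over nonempty sets and
   are attained: they are the distances from YX of the two hypercycles with
   leading line YX which touch K and bound a strip containing K. *)
Definition shadow_pos K Y X : R :=
  sup [set dist_to_line Y X p | p in K `&` half_plane_pos Y X].

Definition shadow_neg K Y X : R :=
  sup [set dist_to_line Y X p | p in K `&` half_plane_neg Y X].

Definition shadow K Y X : R := shadow_pos K Y X + shadow_neg K Y X.

Definition compact_convex_body K : Prop :=
  [/\ K `<=` hplane, compact K, convex_set K & K° !=set0].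

Definition constant_shadow K (d : R) : Prop :=
  forall X Y, ideal X -> ideal Y -> X <> Y ->
    hline Y X `&` K !=set0 -> shadow K Y X = d.

Definition is_diameter K (d : R) : Prop :=
  (exists p q, [/\ K p, K q & hdist p q = d]) /\
  (forall p q, K p -> K q -> hdist p q <= d).

Definition boundary K : set (plane R) := closure K `\` K°.

(* A chord of K is a segment joining two boundary points of K. *)
Definition constant_diameter K (d : R) : Prop :=
  is_diameter K d /\
  (forall p, boundary K p -> exists2 q, boundary K q & hdist p q = d).

End HyperbolicPlane.

(* Main.v *)
Require Import Defs.
From mathcomp Require Import all_boot all_order all_algebra.
From mathcomp Require Import all_classical all_reals all_analysis.
From mathcomp Require Import ring lra.

(** No point of K is farther than d from a line meeting K.  For two points p
    and q of K, the line through p perpendicular to pq shows dist(p, q) <= d.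
    For a boundary point p, a support line of K at p has shadow 0 on one side,
    so some point b of K lies at distance d from it; hence dist(p, b) >= d, and
    so dist(p, b) = d.  Such a b is a boundary point, since otherwise the
    segment pb could be prolonged inside K beyond the length d. *)

Set Implicit Arguments.
Unset Strict Implicit.
Unset Printing Implicit Defensive.

Import Order.TTheory GRing.Theory Num.Theory.
Import numFieldNormedType.Exports.

Local Open Scope classical_set_scope.
Local Open Scope ring_scope.

Section KleinModel.
Context (R : realType).
Implicit Types (p q r u v w X Y : plane R) (K : set (plane R)).

(** * Distances in the Klein disk *)

Lemma arcosh_ge0 (x : R) : 1 <= x -> 0 <= arcosh x.
Proof.
by move=> x1; apply: ln_ge0; rewrite (le_trans x1)// lerDl sqrtr_ge0.
Qed.

Lemma ler_arcosh (x y : R) : 1 <= x -> 1 <= y ->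
  (arcosh x <= arcosh y) = (x <= y).
Proof.
have mono (a b : R) : 1 <= a -> a < b -> arcosh a < arcosh b.
  move=> a1 ab; have sa := sqrtr_ge0 (a ^+ 2 - 1).
  have sab : Num.sqrt (a ^+ 2 - 1) <= Num.sqrt (b ^+ 2 - 1).
    by apply: ler_wsqrtr; nra.
  by rewrite /arcosh ltr_ln ?posrE; lra.
move=> x1 y1; case: (leP x y) => [|yx].
  2: by apply/negbTE; rewrite -ltNge mono.
by rewrite le_eqVlt => /predU1P[->|xy]; rewrite ?lexx// ltW// mono.
Qed.

Lemma scaleRE (a : R) (b : R^o) : a *: b = a * b.
Proof. by []. Qed.

Lemma dotC p q : dot p q = dot q p.
Proof. by rewrite /dot mulrC [in X in _ + X]mulrC. Qed.

Lemma hdistC p q : hdist p q = hdist q p.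
Proof. by rewrite /hdist dotC [X in Num.sqrt X]mulrC. Qed.

(* The left-hand side is a positive multiple of sinh^2 of the distance between
   p and p + w. *)
Lemma dot_gram p w :
  (1 - dot p (p + w)) ^+ 2 - (1 - dot p p) * (1 - dot (p + w) (p + w)) =
  dot w w - (p.1 * w.2 - p.2 * w.1) ^+ 2.
Proof. by rewrite /dot /=; ring. Qed.

Lemma dot_gt0 p : p != 0 -> 0 < dot p p.
Proof.
case: p => a b; rewrite /dot/= => ab0.
rewrite lt_def addr_ge0// ?andbT -?expr2 ?sqr_ge0// !expr2.
apply: contraNneq ab0 => s0; have [a0 b0] : a = 0 /\ b = 0.
  have h : a * a == 0 by apply/eqP; nra.
  have h' : b * b == 0 by apply/eqP; nra.
  by move: h h'; rewrite !mulf_eq0 !orbb => /eqP -> /eqP ->.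
by rewrite a0 b0.
Qed.

(** By Lagrange's identity the squared determinant of [p] and [w] is at most [dot p p * dot w w],
    and [dot p p < 1]. *)
Lemma gram_gt0 p w : hplane p -> w != 0 ->
  0 < dot w w - (p.1 * w.2 - p.2 * w.1) ^+ 2.
Proof.
move=> pD /dot_gt0; move: pD; rewrite /hplane /dot /=.
case: p w => a b [x y] /= pD w0.
have : 0 <= (a * x + b * y) ^+ 2 by exact: sqr_ge0.
nra.
Qed.

Lemma hplane_dot p q : hplane p -> hplane q -> 0 < 1 - dot p q.
Proof.
case: p q => a b [x y]; rewrite /hplane /dot /= => pD qD.
have := sqr_ge0 (a - x); have := sqr_ge0 (b - y); nra.
Qed.

(** The reversed Cauchy-Schwarz inequality for the timelike vectors (1, p) and (1, q); it keeps the
    argument of [arcosh] at least 1. *)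
Lemma dot_lorentz p q : hplane p ->
  (1 - dot p p) * (1 - dot q q) <= (1 - dot p q) ^+ 2.
Proof.
move=> pD; rewrite -subr_ge0; have := dot_gram p (q - p).
rewrite [p + (q - p)]addrC subrK => ->.
have [->|] := eqVneq (q - p) 0; last by move=> /(gram_gt0 pD)/ltW.
by rewrite /dot /= !(mulr0, subr0, addr0) expr0n subr0.
Qed.

Lemma coshdist_ge1 p q : hplane p -> hplane q ->
  1 <= (1 - dot p q) / Num.sqrt ((1 - dot p p) * (1 - dot q q)).
Proof.
move=> pD qD; have p0 := hplane_dot pD pD; have q0 := hplane_dot qD qD.
have pq0 := hplane_dot pD qD.
rewrite ler_pdivlMr ?sqrtr_gt0 ?mulr_gt0// mul1r.
by rewrite -(ger0_norm (ltW pq0)) -sqrtr_sqr ler_wsqrtr// dot_lorentz.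
Qed.

Lemma hdist_ge0 p q : hplane p -> hplane q -> 0 <= hdist p q.
Proof. by move=> pD qD; apply: arcosh_ge0; exact: coshdist_ge1. Qed.

Lemma hdistxx p : hplane p -> hdist p p = 0.
Proof.
move=> pD; have p0 := hplane_dot pD pD.
rewrite /hdist -expr2 sqrtr_sqr ger0_norm ?ltW// divff ?gt_eqF//.
by rewrite /arcosh expr1n subrr sqrtr0 addr0 ln1.
Qed.

(* The ratios compared on the right are the squares of cosh of the distances. *)
Lemma ler_hdist p q p' q' : hplane p -> hplane q -> hplane p' -> hplane q' ->
  (hdist p q <= hdist p' q') =
  ((1 - dot p q) ^+ 2 / ((1 - dot p p) * (1 - dot q q)) <=
   (1 - dot p' q') ^+ 2 / ((1 - dot p' p') * (1 - dot q' q'))).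
Proof.
have sq (x y : plane R) : hplane x -> hplane y ->
    (1 - dot x y) ^+ 2 / ((1 - dot x x) * (1 - dot y y)) =
    ((1 - dot x y) / Num.sqrt ((1 - dot x x) * (1 - dot y y))) ^+ 2.
  move=> xD yD; rewrite expr_div_n sqr_sqrtr//.
  by rewrite ltW// mulr_gt0// hplane_dot.
move=> pD qD p'D q'D; rewrite /hdist ler_arcosh ?coshdist_ge1// !sq//.
by rewrite ler_sqr// nnegrE (le_trans ler01)// coshdist_ge1.
Qed.

(** Let r be the prolonged point. By [dot_gram], cosh^2 of the distance from p exceeds 1 by C / ((1
    - |p|^2)(1 - |q|^2)) at q and by t^2 C / ((1 - |p|^2)(1 - |r|^2)) at r, with the same C > 0. So
    it is enough that 1 - |r|^2 < t^2 (1 - |q|^2). *)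
Lemma hdist_extend p q (t : R) : hplane p -> hplane q -> q != p -> 1 < t ->
  hplane (p + t *: (q - p)) -> hdist q p < hdist (p + t *: (q - p)) p.
Proof.
move=> pD qD qp t1 rD; set r := p + _ in rD *.
have p0 := hplane_dot pD pD; have q0 := hplane_dot qD qD.
have r0 := hplane_dot rD rD; have pr0 := hplane_dot pD rD.
have pq0 := hplane_dot pD qD.
rewrite ltNge ler_hdist// -ltNge ltr_pdivrMr ?mulr_gt0//.
rewrite mulrAC ltr_pdivlMr ?mulr_gt0//.
rewrite !(mulrC _ (1 - dot p p)) !(mulrCA _ (1 - dot p p)) ltr_pM2l//.
have w0 : q - p != 0 by rewrite subr_eq0.
have C0 := gram_gt0 pD w0; have Eq := dot_gram p (q - p).
have Er := dot_gram p (t *: (q - p)).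
move: Eq; rewrite [p + (q - p)]addrC subrK => Eq.
have QE : 1 - dot q q =
    1 - dot p p - 2 * dot p (q - p) - dot (q - p) (q - p).
  by rewrite /dot /=; ring.
have rE : 1 - dot r r = 1 - dot p p - 2 * (t * dot p (q - p))
    - t ^+ 2 * dot (q - p) (q - p).
  by rewrite /r /dot /= !scaleRE; ring.
have pqE : 1 - dot p q = 1 - dot p p - dot p (q - p) by rewrite /dot /=; ring.
have prE : 1 - dot p r = 1 - dot p p - t * dot p (q - p).
  by rewrite /r /dot /= !scaleRE; ring.
have rQ : 1 - dot r r < t ^+ 2 * (1 - dot q q).
  (* The product is t^2 (1 - |q|^2) - (1 - |r|^2) in factored form. *)
  have pos : 0 < (t - 1) * (t * (1 - dot p q) + (1 - dot p r)).
    apply: mulr_gt0; first by rewrite subr_gt0.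
    by apply: addr_gt0 => //; apply: mulr_gt0 => //; exact: lt_trans t1.
  by move: pos; rewrite rE QE pqE prE; lra.
have {}Er : (1 - dot p r) ^+ 2 = (1 - dot p p) * (1 - dot r r) + t ^+ 2 *
    (dot (q - p) (q - p) - (p.1 * (q - p).2 - p.2 * (q - p).1) ^+ 2).
  transitivity (((1 - dot p r) ^+ 2 - (1 - dot p p) * (1 - dot r r)) +
      (1 - dot p p) * (1 - dot r r)); first by rewrite subrK.
  by rewrite Er addrC /dot /= !scaleRE; ring.
move/eqP: Eq; rewrite subr_eq => /eqP Eq.
rewrite (dotC q p) (dotC r p) Eq Er.
rewrite -subr_gt0 in rQ; have := mulr_gt0 C0 rQ; lra.
Qed.

(** * Chords and perpendiculars *)

Lemma dot_ideal_lt1 X Y : ideal X -> ideal Y -> X <> Y -> dot Y X < 1.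
Proof.
rewrite /ideal /= => XX YY XY.
have /dot_gt0 : X - Y != 0 by rewrite subr_eq0; apply/eqP.
have -> : dot (X - Y) (X - Y) = dot X X + dot Y Y - 2 * dot Y X.
  by rewrite /dot /=; ring.
by rewrite XX YY; lra.
Qed.

(** The point with parameter s on the Euclidean line through Y and X has 1 - |.|^2 = 2 s (1 - s) (1
    - dot Y X), which is positive exactly when 0 < s < 1. *)
Lemma hlineP X Y r : ideal X -> ideal Y -> X <> Y ->
  hline Y X r <-> hplane r /\ side Y X r = 0.
Proof.
move=> Xi Yi XY; have XY1 := dot_ideal_lt1 Xi Yi XY.
have dotE (s : R) : 1 - dot ((1 - s) *: Y + s *: X) ((1 - s) *: Y + s *: X) =
    (1 - (1 - s) ^+ 2 - s ^+ 2) - 2 * (s * (1 - s) * dot Y X).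
  have -> : dot ((1 - s) *: Y + s *: X) ((1 - s) *: Y + s *: X) =
      (1 - s) ^+ 2 * dot Y Y + s ^+ 2 * dot X X +
      2 * (s * (1 - s) * dot Y X) by rewrite /dot /= !scaleRE; ring.
  by rewrite (Xi : dot X X = 1) (Yi : dot Y Y = 1); ring.
split => [[s]|[rD rs]].
  rewrite /= in_itv/= => /andP[s0 s1] <-; split.
    rewrite /hplane /= -subr_gt0 dotE.
    have -> : 1 - (1 - s) ^+ 2 - s ^+ 2 - 2 * (s * (1 - s) * dot Y X) =
        2 * (s * (1 - s) * (1 - dot Y X)) by ring.
    by rewrite !mulr_gt0// subr_gt0.
  by rewrite /side /= !scaleRE; ring.
have w0 : 0 < dot (X - Y) (X - Y).
  by apply: dot_gt0; rewrite subr_eq0; apply/eqP.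
(* The parameter of the orthogonal projection of r to the line, which is r itself because [side]
   vanishes there. *)
pose s := dot (r - Y) (X - Y) / dot (X - Y) (X - Y).
have rE : r = (1 - s) *: Y + s *: X.
  have sE : s * dot (X - Y) (X - Y) = dot (r - Y) (X - Y).
    by rewrite /s divfK// gt_eqF.
  apply/eqP; rewrite -subr_eq0; apply/eqP.
  move: s sE w0 rs {rD dotE XY1 XY Xi Yi} => s.
  case: X Y r => X1 X2 [Y1 Y2] [r1 r2]; rewrite /dot /side /= => sE w0 rs.
  congr pair; rewrite /= !scaleRE; apply: (mulIf (lt0r_neq0 w0)).
    have := congr1 ( *%R (X1 - Y1)) sE; have := congr1 ( *%R (X2 - Y2)) rs.
    by rewrite mul0r mulr0; lra.
  have := congr1 ( *%R (X2 - Y2)) sE; have := congr1 ( *%R (X1 - Y1)) rs.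
  by rewrite mul0r mulr0; lra.
move: rD; rewrite /hplane /= -subr_gt0 [in dot r r]rE dotE => rD.
exists s; last by rewrite -rE.
have : 0 < 2 * (s * (1 - s) * (1 - dot Y X)) by lra.
rewrite pmulr_rgt0// pmulr_lgt0 ?subr_gt0// => ss.
by rewrite /= in_itv/=; apply/andP; split; nra.
Qed.

(** The ideal endpoints come from the two roots a of |p + a u|^2 = 1, real and distinct because p is
    inside the disk. X takes the larger root, and c is the difference of the roots. *)
Lemma line_through p u : hplane p -> u != 0 ->
  exists X Y (c : R), [/\ ideal X, ideal Y, X <> Y, 0 < c &
    forall r, side Y X r = c * (u.1 * (r.2 - p.2) - u.2 * (r.1 - p.1))].
Proof.
move=> pD /dot_gt0 u0; have p0 := hplane_dot pD pD.
have D0 : 0 < dot p u ^+ 2 + dot u u * (1 - dot p p).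
  by rewrite ltr_wpDl ?sqr_ge0 ?mulr_gt0.
pose S := Num.sqrt (dot p u ^+ 2 + dot u u * (1 - dot p p)).
have SS : S ^+ 2 = dot p u ^+ 2 + dot u u * (1 - dot p p).
  by rewrite sqr_sqrtr// ltW.
have S0 : 0 < S by rewrite sqrtr_gt0.
have idealE (e : R) : e ^+ 2 = 1 ->
    ideal (p + ((e * S - dot p u) / dot u u) *: u).
  move=> e1; rewrite /ideal /=; set a := _ / _.
  have -> : dot (p + a *: u) (p + a *: u) =
      dot p p + a * (2 * dot p u + a * dot u u).
    by rewrite /dot /= !scaleRE; ring.
  have -> : a * dot u u = e * S - dot p u by rewrite divfK// gt_eqF.
  have -> : a * (2 * dot p u + (e * S - dot p u)) =
      (e ^+ 2 * S ^+ 2 - dot p u ^+ 2) / dot u u by rewrite /a; ring.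
  rewrite e1 mul1r SS; move: (dot p u) (dot p p) (dot u u) u0 => x y z z0.
  by field; rewrite gt_eqF.
pose a := (1 * S - dot p u) / dot u u; pose b := (-1 * S - dot p u) / dot u u.
have ab : 0 < a - b.
  by rewrite -mulrBl divr_gt0//; lra.
exists (p + a *: u), (p + b *: u), (a - b); split=> //.
- by apply: idealE; ring.
- by apply: idealE; ring.
- move=> /addrI /eqP; rewrite -subr_eq0 -scalerBl => /eqP h.
  have : dot ((a - b) *: u) ((a - b) *: u) = (a - b) ^+ 2 * dot u u.
    by rewrite /dot /= !scaleRE; ring.
  rewrite h; have := mulr_gt0 (exprn_gt0 2 ab) u0.
  rewrite {2}/dot /= !mul0r addr0.
  by move=> /[swap] <-; rewrite ltxx.
- by move=> r; rewrite /side /= !scaleRE; ring.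
Qed.

(** For r on the perpendicular to pq at p, the hyperbolic Pythagorean theorem gives cosh d(q, r) =
    cosh d(q, p) cosh d(p, r), and the last factor is at least 1. *)
Lemma perpendicular_line p q : hplane p -> hplane q -> q != p ->
  exists X Y, [/\ ideal X, ideal Y, X <> Y, hline Y X p &
    forall r, hline Y X r -> hdist q p <= hdist q r].
Proof.
move=> pD qD qp; have p0 := hplane_dot pD pD; have q0 := hplane_dot qD qD.
have pq0 := hplane_dot pD qD.
(* A Euclidean normal of the chord sought: [dot w (r - p) = 0] is the Pythagorean relation [e]
   below, with denominators cleared. *)
pose w := (1 - dot p p) *: q - (1 - dot p q) *: p.
have w0 : 0 < dot w (q - p).
  have -> : dot w (q - p) =
      (1 - dot p p) * dot (q - p) (q - p) + dot p (q - p) ^+ 2.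
    by rewrite /w /dot /= !scaleRE; ring.
  by rewrite ltr_pwDl ?sqr_ge0// mulr_gt0// dot_gt0// subr_eq0.
have u0 : (- w.2, w.1) != 0 :> plane R.
  apply: contraTneq w0 => h.
  have w2 : w.2 = 0 by apply: oppr_inj; rewrite oppr0; exact: (congr1 fst h).
  have w1 : w.1 = 0 := congr1 snd h.
  by rewrite /dot w1 w2 !mul0r addr0 ltxx.
have [X [Y [c [Xi Yi XY c0 sE]]]] := line_through pD u0.
exists X, Y; split=> //.
  by apply/hlineP => //; split=> //; rewrite sE !subrr !mulr0 subr0 mulr0.
move=> r /hlineP[]// rD; rewrite sE => /eqP.
rewrite mulf_eq0 gt_eqF//= => /eqP rw.
have r0 := hplane_dot rD rD.
have e : (1 - dot q r) * (1 - dot p p) = (1 - dot p q) * (1 - dot p r).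
  apply/eqP; rewrite -subr_eq0 -rw; apply/eqP.
  by rewrite /w /dot /= !scaleRE; ring.
rewrite ler_hdist// ler_pdivrMr ?mulr_gt0// mulrAC ler_pdivlMr ?mulr_gt0//.
rewrite !(mulrCA _ (1 - dot q q)) ler_pM2l// -(ler_pM2r p0) (dotC q p).
have -> : (1 - dot q r) ^+ 2 * (1 - dot p p) * (1 - dot p p) =
    ((1 - dot q r) * (1 - dot p p)) ^+ 2 by ring.
rewrite e exprMn -mulrA ler_pM2l ?exprn_gt0// mulrC.
exact: dot_lorentz.
Qed.

(** * Convex sets and support lines *)

Lemma convex_comb K p q (t : R) : convex_set K -> K p -> K q ->
  0 <= t -> t <= 1 -> K (p + t *: (q - p)).
Proof.
move=> Kc Kp Kq t0 t1.
have := Kc q p (Itv01 t0 t1) (mem_set Kq) (mem_set Kp).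
move=> /set_mem; congr K.
rewrite /conv /= /unstable.onem.
by rewrite scalerBl scale1r scalerBr addrCA.
Qed.

Lemma interior_extend K p v : K° p -> exists2 t : R, 0 < t & K (p + t *: v).
Proof.
move=> pK; have cf : (fun t : R => p + t *: v) @ 0 --> p.
  rewrite -[X in _ --> X]addr0 -(scale0r v); apply: cvgD; first exact: cvg_cst.
  by apply: cvgZr_tmp; exact: cvg_id.
have /nbhs_ballP[e /= e0 eK] := cf _ pK.
exists (e / 2); first by rewrite divr_gt0.
apply: eK; rewrite /ball /= sub0r normrN gtr0_norm ?divr_gt0//.
by rewrite ltr_pdivrMr// ltr_pMr// ltr1n.
Qed.

(** The homothety with centre p and ratio 1/t takes the point to q, so the preimage of K under it is
    a neighbourhood of the point; by convexity this preimage lies in K. *)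
Lemma interior_conv K p q (t : R) : convex_set K -> K p -> K° q ->
  0 < t -> t <= 1 -> K° (p + t *: (q - p)).
Proof.
move=> Kc Kp qK t0 t1.
have cf : (fun y : plane R => p + t^-1 *: (y - p)) @ (p + t *: (q - p)) --> q.
  have {2}-> : q = p + t^-1 *: (p + t *: (q - p) - p).
    have -> : p + t *: (q - p) - p = t *: (q - p) by rewrite addrAC subrr add0r.
    by rewrite scalerA mulVf ?gt_eqF// scale1r addrC subrK.
  apply: cvgD; first exact: cvg_cst.
  apply: (@cvgZl_tmp _ _ _ _ _ t^-1 (fun y : plane R => y - p)).
  by apply: cvgB; [exact: cvg_id|exact: cvg_cst].
suff sub : (fun y => K (p + t^-1 *: (y - p))) `<=` K.
  exact: (filterS sub (cf _ qK)).
move=> y /= yK.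
suff -> : y = p + t *: ((p + t^-1 *: (y - p)) - p).
  exact: convex_comb (ltW t0) t1.
by rewrite addrAC subrr add0r scalerA divff ?gt_eqF// scale1r addrC subrK.
Qed.

(* Otherwise p lies strictly between the interior point z and a point of K. *)
Lemma boundary_not_beyond K p z (s : R) : convex_set K -> K° z -> ~ K° p ->
  s < 0 -> ~ K (p + s *: (z - p)).
Proof.
move=> Kc zK pK s0 kK; apply: pK.
have t0 : 0 < - s / (1 - s) by rewrite divr_gt0; lra.
have t1 : - s / (1 - s) <= 1 by rewrite ler_pdivrMr; lra.
have := interior_conv Kc kK zK t0 t1; congr (K° _).
have s1 : 1 - s != 0 by rewrite gt_eqF; lra.
case: p z {kK zK} => p1 p2 [z1 z2].
by congr pair; rewrite /= !scaleRE; field.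
Qed.

(** The segment kl meets the line pz at p + s (z - p), where s has the sign of the expression
    bounded here; s < 0 is excluded by [boundary_not_beyond]. *)
Lemma boundary_slopes K p z k l :
  convex_set K -> K° z -> ~ K° p -> K k -> K l ->
  side p z l < 0 -> 0 <= side p z k ->
  0 <= dot (z - p) (k - p) * - side p z l + dot (z - p) (l - p) * side p z k.
Proof.
move=> Kc zK pK Kk Kl bl bk; rewrite leNgt; apply/negP => neg.
have e0 : 0 < dot (z - p) (z - p).
  by apply: dot_gt0; rewrite subr_eq0; apply/eqP => zp; apply: pK; rewrite -zp.
pose D := side p z k - side p z l.
have D0 : 0 < D by rewrite /D; lra.
(* Chosen so that [side p z] vanishes at k + t (l - k). *)
pose t := side p z k / D.
have t0 : 0 <= t by rewrite divr_ge0// ltW.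
have t1 : t <= 1 by rewrite ler_pdivrMr// mul1r /D; lra.
have := convex_comb Kc Kk Kl t0 t1.
pose s := (dot (z - p) (k - p) * - side p z l +
  dot (z - p) (l - p) * side p z k) / (D * dot (z - p) (z - p)).
have s0 : s < 0 by rewrite pmulr_llt0// invr_gt0 mulr_gt0.
suff -> : k + t *: (l - k) = p + s *: (z - p) by exact: boundary_not_beyond.
have D0' : D != 0 by rewrite gt_eqF.
have e0' : dot (z - p) (z - p) != 0 by rewrite gt_eqF.
move: D0' e0'; rewrite /s /t /D.
case: p z k l {zK pK Kk Kl bl bk neg e0 D D0 t t0 t1 s s0}.
move=> p1 p2 [z1 z2] [k1 k2] [l1 l2].
rewrite /side /dot /= => D0 e0.
by congr pair; rewrite /= !scaleRE; field; rewrite D0 e0.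
Qed.

(* The one-dimensional step of Hahn-Banach: in the basis z - p and its rotation
   by a quarter turn, with z an interior point, a supporting slope is any number
   between the slopes, seen from p, of the points of K on either side of pz;
   boundary_slopes says that these are separated. *)
Lemma support_line K p : convex_set K -> K°!=set0 -> ~ K° p ->
  exists2 u : plane R, u != 0 &
    forall k, K k -> u.1 * (k.2 - p.2) - u.2 * (k.1 - p.1) <= 0.
Proof.
move=> Kc [z zK] pK.
have zp0 : z - p != 0.
  by rewrite subr_eq0; apply/eqP => zp; apply: pK; rewrite -zp.
have e0 := dot_gt0 zp0.
pose n : plane R := (- (z - p).2, (z - p).1).
have sideE (t : R) : side p z (z + t *: n) = t * dot (z - p) (z - p).
  by rewrite /side /dot /= !scaleRE; ring.
(* Moving z along n and along -n gives points of K strictly on both sides of pz; hence the set [A]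
   of slopes is nonempty and bounded above, and [m] is a genuine supremum. *)
have [t t0 Kt] := interior_extend n zK.
have [t' t'0 Kt'] := interior_extend (- n) zK.
pose A := [set dot (z - p) (l - p) / side p z l |
  l in K `&` [set l | side p z l < 0]].
have A0 : A !=set0.
  exists (dot (z - p) (z + (- t') *: n - p) / side p z (z + (- t') *: n)).
  exists (z + (- t') *: n) => //; split; first by rewrite scaleNr -scalerN.
  by rewrite /= sideE mulNr oppr_lt0 mulr_gt0.
have Aub k : K k -> 0 < side p z k ->
    ubound A (dot (z - p) (k - p) / side p z k).
  move=> Kk k0 _ [l [Kl /= l0] <-].
  have := boundary_slopes Kc zK pK Kk Kl l0 (ltW k0).
  rewrite ler_pdivlMr// mulrAC ler_ndivrMr//; lra.
have Asup : has_sup A.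
  split=> //; exists (dot (z - p) (z + t *: n - p) / side p z (z + t *: n)).
  by apply: Aub => //; rewrite sideE mulr_gt0.
pose m := sup A.
have uE k : (m * (z - p).1 - (z - p).2) * (k.2 - p.2)
     - (m * (z - p).2 + (z - p).1) * (k.1 - p.1) =
   m * side p z k - dot (z - p) (k - p) by rewrite /side /dot /=; ring.
(* This is u = m (z - p) + n, of squared length (m^2 + 1) |z - p|^2. *)
exists (m * (z - p).1 - (z - p).2, m * (z - p).2 + (z - p).1).
  apply/eqP => -[u1 u2].
  have : (m ^+ 2 + 1) * dot (z - p) (z - p) = 0.
    transitivity ((m * (z - p).1 - (z - p).2) ^+ 2
      + (m * (z - p).2 + (z - p).1) ^+ 2); first by rewrite /dot /=; ring.
    by rewrite /= u1 u2 expr0n addr0.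
  by move/eqP; rewrite gt_eqF// mulr_gt0// ltr_wpDl// sqr_ge0.
move=> k Kk; rewrite [leLHS]uE subr_le0.
have [k0|k0|k0] := ltgtP (side p z k) 0.
- rewrite -ler_ndivrMr//; apply: sup_upper_bound => //.
  by exists k.
- by rewrite -ler_pdivlMr//; apply: ge_sup => //; exact: Aub.
(* A point k on the line pz has no slope; comparing it with an auxiliary point l on the negative
   side shows that k is not behind p. *)
- rewrite k0 mulr0; have l0 : side p z (z + (- t') *: n) < 0.
    by rewrite sideE mulNr oppr_lt0 mulr_gt0.
  have Kl : K (z + (- t') *: n) by rewrite scaleNr -scalerN.
  have := boundary_slopes Kc zK pK Kk Kl l0.
  by rewrite k0 lexx mulr0 addr0 => /(_ isT); rewrite pmulr_lge0// oppr_gt0.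
Qed.

(** * Farthest points and distances to a line *)

Lemma farthest_point K p :
  compact K -> K !=set0 -> K `<=` @hplane R -> hplane p ->
  exists2 b, K b & forall k, K k -> hdist k p <= hdist b p.
Proof.
move=> Kcpt K0 KD pD; have p0 := hplane_dot pD pD.
(* cosh^2 of the distance to p orders points as the distance does, and it is a rational function
   whose denominator is positive on K. *)
pose f (k : plane R) : R :=
  (1 - dot k p) ^+ 2 / ((1 - dot k k) * (1 - dot p p)).
have fc : {within K, continuous f}.
  apply: continuous_in_subspaceT => k /set_mem Kk.
  have c1 : (fun x : plane R => x.1) @ k --> (k.1 : R) by exact: cvg_fst.
  have c2 : (fun x : plane R => x.2) @ k --> (k.2 : R) by exact: cvg_snd.
  have dc (g1 g2 : plane R -> R) : g1 @ k --> g1 k -> g2 @ k --> g2 k ->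
      (fun x : plane R => x.1 * g1 x + x.2 * g2 x) @ k -->
      k.1 * g1 k + k.2 * g2 k.
    by move=> g1c g2c; apply: cvgD; apply: cvgM.
  apply: cvgM.
    by apply: cvgM; (apply: cvgB; [exact: cvg_cst|]);
      apply: (dc (fun=> p.1) (fun=> p.2)); exact: cvg_cst.
  apply: cvgV; first by rewrite gt_eqF// mulr_gt0// hplane_dot//; exact: KD.
  apply: cvgM; last exact: cvg_cst.
  apply: cvgB; first exact: cvg_cst.
  exact: (dc (fun x => x.1) (fun x => x.2)).
have [b /set_mem Kb bmax] := compact_EVT_max K0 Kcpt fc.
exists b => // k Kk; rewrite ler_hdist//; try exact: KD.
exact/bmax/mem_set.
Qed.

Lemma hline_hplane X Y :
  ideal X -> ideal Y -> X <> Y -> hline Y X `<=` @hplane R.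
Proof. by move=> Xi Yi XY r /hlineP[]. Qed.

Lemma dist_to_line_ge X Y p (x : R) : hline Y X !=set0 ->
  (forall r, hline Y X r -> x <= hdist p r) -> x <= dist_to_line Y X p.
Proof.
move=> [r rl] xle; apply: lb_le_inf; first by exists (hdist p r), r.
by move=> _ [q ql <-]; exact: xle.
Qed.

Lemma dist_to_line_le X Y p q : ideal X -> ideal Y -> X <> Y -> hplane p ->
  hline Y X q -> dist_to_line Y X p <= hdist p q.
Proof.
move=> Xi Yi XY pD ql; apply: ge_inf; last by exists q.
exists 0 => _ [r rl <-]; apply: hdist_ge0 => //; exact: hline_hplane rl.
Qed.

Lemma dist_to_line_ge0 X Y p : ideal X -> ideal Y -> X <> Y -> hplane p ->
  hline Y X !=set0 -> 0 <= dist_to_line Y X p.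
Proof.
move=> Xi Yi XY pD l0; apply: dist_to_line_ge => // r rl.
by apply: hdist_ge0 => //; exact: hline_hplane rl.
Qed.

Lemma dist_to_line0 X Y p : ideal X -> ideal Y -> X <> Y ->
  hline Y X p -> dist_to_line Y X p = 0.
Proof.
move=> Xi Yi XY pl; have pD := hline_hplane Xi Yi XY pl.
apply/eqP; rewrite eq_le dist_to_line_ge0 ?andbT//; last by exists p.
by rewrite -(hdistxx pD) dist_to_line_le.
Qed.

(** * Bodies with constant shadow *)

Section ConstantShadow.
Context (K : set (plane R)) (d : R).
Context (Kbody : compact_convex_body K) (d0 : 0 < d).
Context (shadowK : constant_shadow K d).

Let KD : K `<=` @hplane R. Proof. by case: Kbody. Qed.
Let Kcpt : compact K. Proof. by case: Kbody. Qed.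
Let Kc : convex_set K. Proof. by case: Kbody. Qed.
Let Kint : K° !=set0. Proof. by case: Kbody. Qed.

(** The supremum is over a set bounded above: a point of K is no farther from the line than from p,
    and K has a point farthest from p. *)
Lemma dist_to_line_sup X Y p k (H : set (plane R)) :
  ideal X -> ideal Y -> X <> Y -> hline Y X p -> K k -> H k ->
  dist_to_line Y X k <= sup [set dist_to_line Y X x | x in K `&` H].
Proof.
move=> Xi Yi XY pl Kk Hk; have pD := hline_hplane Xi Yi XY pl.
have [b Kb bmax] := farthest_point Kcpt (ex_intro _ _ Kk) KD pD.
apply: ub_le_sup; last by exists k.
exists (hdist b p) => _ [x [Kx _] <-]; apply: le_trans (bmax x Kx).
by apply: dist_to_line_le => //; exact: KD.
Qed.

Lemma hdist_le_shadow p q : K p -> K q -> hdist q p <= d.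
Proof.
move=> Kp Kq; have pD := KD Kp; have qD := KD Kq.
have [->|qp] := eqVneq q p; first by rewrite hdistxx// ltW.
have [X [Y [Xi Yi XY pl perp]]] := perpendicular_line pD qD qp.
rewrite -(shadowK Xi Yi XY); last by exists p.
have qle : hdist q p <= dist_to_line Y X q.
  by apply: dist_to_line_ge => //; exists p.
have [_ ps] := (hlineP _ Xi Yi XY).1 pl.
(* The point p lies in both closed half-planes at distance 0 from the line, so neither summand of
   the shadow is negative and the one on the side of q is at most d. *)
have pos0 : 0 <= shadow_pos K Y X.
  rewrite -(dist_to_line0 Xi Yi XY pl); apply: dist_to_line_sup pl _ _ => //.
  by split=> //=; rewrite ps.
have neg0 : 0 <= shadow_neg K Y X.
  rewrite -(dist_to_line0 Xi Yi XY pl); apply: dist_to_line_sup pl _ _ => //.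
  by split=> //=; rewrite ps.
apply: le_trans qle _; rewrite /shadow.
have [s0|s0] := leP 0 (side Y X q).
  apply: ler_wpDr => //; exact: dist_to_line_sup pl _ _.
apply: ler_wpDl => //; apply: dist_to_line_sup pl _ _ => //.
by split=> //; exact: ltW.
Qed.

Lemma farthest_from_boundary p : K p -> ~ K° p ->
  exists2 q, K q & hdist q p = d.
Proof.
move=> Kp pK; have pD := KD Kp.
(* Here b is farthest from p rather than from the support line; its distance to p still bounds the
   distance of every point of K to that line. *)
have [b Kb bmax] := farthest_point Kcpt (ex_intro _ _ Kp) KD pD.
exists b => //; apply/eqP; rewrite eq_le hdist_le_shadow//=.
have [u u0 supp] := support_line Kc Kint pK.
have [X [Y [c [Xi Yi XY c0 sE]]]] := line_through pD u0.
have pl : hline Y X p.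
  by apply/hlineP => //; split=> //; rewrite sE !subrr !mulr0 subr0 mulr0.
rewrite -(shadowK Xi Yi XY); last by exists p.
have sle k : K k -> side Y X k <= 0.
  by move=> Kk; rewrite sE pmulr_rle0// supp.
(* Points of K in the positive closed half-plane lie on the support line and contribute 0; the
   negative part is at most the distance from b to p. Both sets contain the value at p, so they are
   nonempty. *)
rewrite /shadow -[leRHS]add0r; apply: lerD; apply: ge_sup.
- exists (dist_to_line Y X p), p => //; split=> //; split=> //=.
  by have [_ ->] := (hlineP _ Xi Yi XY).1 pl.
- move=> _ [k [Kk [_ /= sk]] <-]; rewrite dist_to_line0//.
  apply/hlineP => //; split; first exact: KD.
  by apply/eqP; rewrite eq_le sk sle.
- exists (dist_to_line Y X p), p => //; split=> //; split=> //=; exact: sle.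
- move=> _ [k [Kk _] <-]; apply: le_trans (bmax k Kk).
  by apply: dist_to_line_le => //; exact: KD.
Qed.

Lemma diametral_not_interior p q : K p -> K q -> hdist q p = d -> ~ K° q.
Proof.
move=> Kp Kq qpd /(interior_extend (q - p))[t t0 Kt].
have pD := KD Kp; have qD := KD Kq.
have qp : q != p by apply: contra_eq_neq qpd => ->; rewrite hdistxx// lt_eqF.
have qE : q + t *: (q - p) = p + (1 + t) *: (q - p).
  by rewrite scalerDl scale1r addrA [p + _]addrC subrK.
rewrite qE in Kt; have t1 : 1 < 1 + t by rewrite ltrDl.
have := hdist_extend pD qD qp t1 (KD Kt).
by rewrite qpd ltNge hdist_le_shadow.
Qed.

(** A point of K with largest first coordinate cannot be moved to the right inside K. It provides a
    pair of points at which the diameter is attained. *)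
Lemma boundary_point : exists2 p, K p & ~ K° p.
Proof.
have K0 : K !=set0 by have [z /interior_subset] := Kint; exists z.
have fc : {within K, continuous (fun x : plane R => x.1 : R)}.
  by apply: continuous_subspaceT => x; exact: cvg_fst.
have [b /set_mem Kb bmax] := compact_EVT_max K0 Kcpt fc.
exists b => // /(interior_extend ((1, 0) : plane R))[t t0 /mem_set/bmax].
by rewrite /= scaleRE mulr1 gerDl leNgt t0.
Qed.
End ConstantShadow.

End KleinModel.

Theorem theorem2 (R : realType) (K : set (plane R)) (d : R) :
  compact_convex_body K -> 0 < d -> constant_shadow K d ->
  constant_diameter K d.
Proof.
move=> Kbody d0 shK; have [KD Kcpt Kc Kint] := Kbody.
split; first split.
- have [p Kp pK] := boundary_point Kbody.
  have [q Kq qp] := farthest_from_boundary Kbody d0 shK Kp pK.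
  by exists q, p.
- by move=> p q Kp Kq; exact: (hdist_le_shadow Kbody d0 shK Kq Kp).
move=> p [clp pK]; have Kp : K p.
  by move: clp; apply: compact_closed => //; exact: norm_hausdorff.
have [q Kq qp] := farthest_from_boundary Kbody d0 shK Kp pK.
exists q; last by rewrite hdistC.
split; first exact: subset_closure.
exact: (diametral_not_interior Kbody d0 shK Kp Kq qp).
Qed.
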